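(* If $G$ is a connected graph with $n\geq 2$ vertices, then \[\sqrt{2}\,X(G)\leq GA(G)\leq\sqrt{2(n-1)}\,X(G).\] The lower bound is attained if and only if $G\cong P_{2}$, and the upper bound is attained if and only if $G\cong K_{n}$.
   Context: Graphs are finite and simple, with vertex set $V(G)=\{v_1,\dots,v_n\}$ and edge set $E(G)$. $d_i$ is the degree of the vertex $v_i$, and $ij$ denotes the edge joining $v_i$ and $v_j$. The sum-connectivity index is $X(G)=\sum_{ij\in E(G)}\frac{1}{\sqrt{d_i+d_j}}$ and the first geometric-arithmetic index is $GA(G)=\sum_{ij\in E(G)}\frac{\sqrt{d_id_j}}{\frac12(d_i+d_j)}$. $P_k$ and $K_k$ denote the path and the complete graph on $k$ vertices. *)

(* Defs.v *)
From HB Require Import structures.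
From mathcomp Require Import all_boot all_order all_algebra.

Set Implicit Arguments.
Unset Strict Implicit.
Unset Printing Implicit Defensive.

Import Order.TTheory GRing.Theory Num.Theory.

Local Open Scope ring_scope.

Record sgraph := SGraph {
  vertex :> finType;
  adj : rel vertex;
  adj_sym : symmetric adj;
  adj_irrefl : irreflexive adj
}.

Definition edges (G : sgraph) : {set {set G}} :=
  [set [set x; y] | x in G, y in G & adj x y].

Definition degree (G : sgraph) (x : G) : nat := #|[set y | adj x y]|.

Definition connected (G : sgraph) : Prop := forall x y : G, connect (@adj G) x y.

Definition isomorphic (G H : sgraph) : Prop :=
  exists2 f : G -> H, bijective f & forall x y, adj (f x) (f y) = adj x y.

Definition path_adj (k : nat) : rel 'I_k :=
  fun i j => (i.+1 == j :> nat) || (j.+1 == i :> nat).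

Lemma path_adj_sym k : symmetric (@path_adj k).
Proof. by move=> i j; rewrite /path_adj orbC. Qed.

Lemma path_adj_irrefl k : irreflexive (@path_adj k).
Proof. by move=> i; rewrite /path_adj orbb gtn_eqF. Qed.

Definition path_graph (k : nat) : sgraph :=
  SGraph (@path_adj_sym k) (@path_adj_irrefl k).

Definition complete_adj (k : nat) : rel 'I_k := fun i j => i != j.

Lemma complete_adj_sym k : symmetric (@complete_adj k).
Proof. by move=> i j; rewrite /complete_adj eq_sym. Qed.

Lemma complete_adj_irrefl k : irreflexive (@complete_adj k).
Proof. by move=> i; rewrite /complete_adj eqxx. Qed.

Definition complete_graph (k : nat) : sgraph :=
  SGraph (@complete_adj_sym k) (@complete_adj_irrefl k).

(* An edge ij is the two-element set e = [set i; j], so the sum (resp. the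
   product) of the degrees over the vertices in e is d_i + d_j (resp. d_i d_j). *)
Definition sum_connectivity (R : rcfType) (G : sgraph) : R :=
  \sum_(e in edges G) 1 / Num.sqrt (\sum_(v in e) (degree v)%:R).

Definition geometric_arithmetic (R : rcfType) (G : sgraph) : R :=
  \sum_(e in edges G)
    Num.sqrt (\prod_(v in e) (degree v)%:R)
      / (1 / 2 * \sum_(v in e) (degree v)%:R).

(* Main.v *)
Require Import Defs.
From HB Require Import structures.
From mathcomp Require Import all_boot all_order all_algebra.
From mathcomp Require Import ring.

Set Implicit Arguments.
Unset Strict Implicit.
Unset Printing Implicit Defensive.

Import Order.TTheory GRing.Theory Num.Theory.

Local Open Scope ring_scope.

(** Both indices are sums over edges, and on an edge ij their terms differ by
the factor sqrt (2 H), where H = 2 d_i d_j / (d_i + d_j) is the harmonic mean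
of the two degrees ([ga_term_factor]).  A harmonic mean lies between any two
positive bounds of its arguments, and reaches one of them only when both
arguments equal it ([harmonic_mean_ge], [harmonic_mean_le]).  In a connected
graph on n >= 2 vertices every degree lies between 1 and n - 1, so summing over
the edges gives the two inequalities.  Equality forces every edge to have both
of its ends of the extremal degree; since no vertex is isolated, the graph is
then 1-regular or (n - 1)-regular ([ga_ge_leif], [ga_le_leif]).  A connected
1-regular graph is a single edge, and an (n - 1)-regular graph is complete. *)

Section HarmonicMean.

Variable R : realFieldType.
Implicit Types a b m : R.

Definition harmonic_mean a b : R := 2 * (a * b) / (a + b).

(** The sign of the difference can be read off: the numerator combines the two
deviations from m with positive weights. *)
Lemma harmonic_mean_sub a b m : 0 < a -> 0 < b ->
  harmonic_mean a b - m = (a * (b - m) + b * (a - m)) / (a + b).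
Proof.
move=> a0 b0; have ab0 : a + b != 0 by rewrite gt_eqF ?addr_gt0.
by rewrite /harmonic_mean; field.
Qed.

Lemma harmonic_mean_ge a b m : 0 < m -> m <= a -> m <= b ->
  m <= harmonic_mean a b ?= iff (m == a) && (m == b).
Proof.
move=> m0 ma mb; have a0 := lt_le_trans m0 ma; have b0 := lt_le_trans m0 mb.
have ab0 := addr_gt0 a0 b0.
have u0 : 0 <= a * (b - m) by rewrite mulr_ge0 ?subr_ge0 ?(ltW a0).
have v0 : 0 <= b * (a - m) by rewrite mulr_ge0 ?subr_ge0 ?(ltW b0).
split.
  by rewrite -subr_ge0 harmonic_mean_sub // divr_ge0 ?addr_ge0 // ltW.
rewrite eq_sym -subr_eq0 harmonic_mean_sub // mulf_eq0 invr_eq0 (gt_eqF ab0).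
rewrite orbF paddr_eq0 // !mulf_eq0 !subr_eq0 (gt_eqF a0) (gt_eqF b0) /=.
by rewrite andbC !(eq_sym m).
Qed.

Lemma harmonic_mean_le a b m : 0 < a -> 0 < b -> a <= m -> b <= m ->
  harmonic_mean a b <= m ?= iff (a == m) && (b == m).
Proof.
move=> a0 b0 am bm; have ab0 := addr_gt0 a0 b0.
have u0 : a * (b - m) <= 0 by rewrite mulr_ge0_le0 ?subr_le0 ?(ltW a0).
have v0 : b * (a - m) <= 0 by rewrite mulr_ge0_le0 ?subr_le0 ?(ltW b0).
split.
  rewrite -subr_le0 harmonic_mean_sub // mulr_le0_ge0 ?invr_ge0 ?(ltW ab0) //.
  by rewrite -(addr0 0) lerD.
rewrite -subr_eq0 harmonic_mean_sub // mulf_eq0 invr_eq0 (gt_eqF ab0).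
rewrite orbF naddr_eq0 // !mulf_eq0 !subr_eq0 (gt_eqF a0) (gt_eqF b0) /=.
by rewrite andbC.
Qed.

End HarmonicMean.

Section EdgeTerms.

Variable R : rcfType.

Lemma ga_term_factor (a b : R) : 0 < a -> 0 < b ->
  Num.sqrt (a * b) / (1 / 2 * (a + b)) =
  Num.sqrt (2 * harmonic_mean a b) * (1 / Num.sqrt (a + b)).
Proof.
move=> a0 b0; have s0 := addr_gt0 a0 b0.
have p0 : 0 <= a * b by rewrite mulr_ge0 // ltW.
have -> : 2 * harmonic_mean a b = 2 ^+ 2 * ((a * b) / (a + b)).
  by rewrite /harmonic_mean; field; rewrite gt_eqF.
rewrite [in RHS]sqrtrM ?exprn_ge0 // sqrtr_sqr ger0_norm //.
rewrite [in RHS]sqrtrM // sqrtrV ?(ltW s0) //.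
rewrite -[in LHS](sqr_sqrtr (ltW s0)).
by field; rewrite gt_eqF // sqrtr_gt0.
Qed.

Lemma ler_sqrt_scale_leif (c d x : R) (C : bool) : 0 <= c -> 0 < x ->
  c <= d ?= iff C -> Num.sqrt c * x <= Num.sqrt d * x ?= iff C.
Proof.
move=> c0 x0 [cd <-]; have d0 := le_trans c0 cd; split.
  by rewrite ler_pM2r // ler_sqrt.
by rewrite (inj_eq (mulIf (lt0r_neq0 x0))) eqr_sqrt.
Qed.

End EdgeTerms.

Section Graphs.

Variable G : sgraph.

Lemma edgesP (e : {set G}) :
  reflect (exists2 xy : G * G, adj xy.1 xy.2 & e = [set xy.1; xy.2])
          (e \in edges G).
Proof.
apply: (iffP imset2P) => [[x y _ yP ->]|[[x y] /= xy ->]].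
  by exists (x, y) => //; move: yP; rewrite inE => /andP[].
by exists x y; rewrite // inE.
Qed.

Lemma adj_neq (x y : G) : adj x y -> x != y.
Proof. by apply: contraTneq => ->; rewrite adj_irrefl. Qed.

Lemma degree_gt0 (x y : G) : adj x y -> (0 < degree x)%N.
Proof. by move=> xy; apply/card_gt0P; exists y; rewrite inE. Qed.

Lemma neighbours_sub (x : G) : [set y | adj x y] \subset [set~ x].
Proof. by apply/subsetP=> y; rewrite !inE => /adj_neq; rewrite eq_sym. Qed.

Lemma degree_le (x : G) : (degree x <= #|G|.-1)%N.
Proof. by rewrite -(cardsC1 x) subset_leq_card ?neighbours_sub. Qed.

Lemma connected_no_isolated : (2 <= #|G|)%N -> connected G ->
  forall x : G, exists y, adj x y.
Proof.
move=> G2 conn x.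
have /card_gt0P[y] : (0 < #|[set~ x]|)%N by rewrite cardsC1 -ltnS prednK // ltnW.
rewrite !inE => yx; case/connectP: (conn x y) => [[|z p] /=].
  by move=> _ yE; rewrite yE eqxx in yx.
by case/andP=> xz _ _; exists z.
Qed.

Section Indices.

Variable R : rcfType.
Hypothesis no_isolated : forall x : G, exists y, adj x y.

Let degR (x : G) : R := (degree x)%:R.

Let degR_gt0 x : 0 < degR x.
Proof. by case: (no_isolated x) => y /degree_gt0; rewrite ltr0n. Qed.

(** Without isolated vertices a property of all vertices is a property of the
ends of all edges, which is how equality in every term of a sum over edges
reaches the vertices. *)
Lemma forall_edge_ends (P : pred G) :
  [forall (e | e \in edges G), [forall (v | v \in e), P v]] = [forall v, P v].
Proof.
apply/forall_inP/forallP => [He v|HP e _]; last by apply/forall_inP.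
have [w vw] := no_isolated v.
have/He/forall_inP : [set v; w] \in edges G by apply/edgesP; exists (v, w).
by apply; rewrite !inE eqxx.
Qed.

Lemma forall_pair_ends (P : pred G) (x y : G) :
  [forall (v | v \in [set x; y]), P v] = P x && P y.
Proof.
apply/forall_inP/andP => [H|[Px Py] v].
  by split; apply: H; rewrite !inE eqxx ?orbT.
by rewrite !inE => /orP[] /eqP->.
Qed.

Lemma ga_ge_leif (m : nat) :
  (0 < m)%N -> (forall x : G, (m <= degree x)%N) ->
  Num.sqrt (2 * m%:R) * sum_connectivity R G <= geometric_arithmetic R G
    ?= iff [forall v : G, m == degree v].
Proof.
move=> m0 mdeg; rewrite -forall_edge_ends /sum_connectivity mulr_sumr.
apply: leif_sum => e /edgesP[[x y] /= xy ->].
have xNy := adj_neq xy; rewrite forall_pair_ends.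
rewrite !big_setU1 ?inE //= !big_set1 ga_term_factor; try exact: degR_gt0.
apply: ler_sqrt_scale_leif; rewrite ?mulr_ge0 ?ler0n //.
  by rewrite div1r invr_gt0 sqrtr_gt0 addr_gt0 //; apply: degR_gt0.
rewrite -!(eqr_nat R).
have [le eq] : (m%:R : R) <= harmonic_mean (degR x) (degR y)
    ?= iff (m%:R == degR x) && (m%:R == degR y).
  by apply: harmonic_mean_ge; rewrite ?ltr0n ?ler_nat.
by split; [rewrite ler_pM2l | rewrite (inj_eq (mulfI _)) ?pnatr_eq0].
Qed.

Lemma ga_le_leif (m : nat) :
  (forall x : G, (degree x <= m)%N) ->
  geometric_arithmetic R G <= Num.sqrt (2 * m%:R) * sum_connectivity R G
    ?= iff [forall v : G, degree v == m].
Proof.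
move=> degm; rewrite -forall_edge_ends /sum_connectivity mulr_sumr.
apply: leif_sum => e /edgesP[[x y] /= xy ->].
have xNy := adj_neq xy; rewrite forall_pair_ends.
rewrite !big_setU1 ?inE //= !big_set1 ga_term_factor; try exact: degR_gt0.
have x0 := degR_gt0 x; have y0 := degR_gt0 y.
apply: ler_sqrt_scale_leif.
- by rewrite mulr_ge0 // divr_ge0 ?addr_ge0 // mulr_ge0 // mulr_ge0.
- by rewrite div1r invr_gt0 sqrtr_gt0 addr_gt0.
rewrite -!(eqr_nat R).
have [le eq] : harmonic_mean (degR x) (degR y) <= m%:R
    ?= iff (degR x == m%:R) && (degR y == m%:R).
  by apply: harmonic_mean_le; rewrite ?ler_nat.
by split; [rewrite ler_pM2l | rewrite (inj_eq (mulfI _)) ?pnatr_eq0].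
Qed.

End Indices.

Lemma regular_complete_adj :
  (forall x : G, degree x = #|G|.-1) <-> (forall x y : G, adj x y = (x != y)).
Proof.
split=> [reg x y | cpl x].
  have /eqP/setP/(_ y) : [set z | adj x z] == [set~ x].
    by rewrite eqEcard neighbours_sub cardsC1 -/(degree x) reg leqnn.
  by rewrite !inE eq_sym.
by rewrite -(cardsC1 x); apply: eq_card => y; rewrite !inE cpl eq_sym.
Qed.

Lemma isomorphic_complete :
  isomorphic G (complete_graph #|G|) <-> forall x : G, degree x = #|G|.-1.
Proof.
rewrite regular_complete_adj; split=> [[f /bij_inj fI fadj] x y | cpl].
  by rewrite -fadj /= /complete_adj (inj_eq fI).
exists enum_rank; first exact: enum_rank_bij.
by move=> x y; rewrite cpl /= /complete_adj (inj_eq enum_rank_inj).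
Qed.

(** The only edge at x leads to some y whose only edge leads back, so no path
leaves the pair formed by x and y. *)
Lemma connected_1regular_card : (2 <= #|G|)%N -> connected G ->
  (forall x : G, degree x = 1%N) -> #|G| = 2%N.
Proof.
move=> G2 conn reg.
have /card_gt0P[x _] : (0 < #|G|)%N by apply: ltnW.
have [y xy] := connected_no_isolated G2 conn x.
have uniq_nb (u v w : G) : adj u v -> adj u w -> w = v.
  have /eqP/cards1P[z /setP nbE] := reg u.
  move=> uv uw; have := nbE v; have := nbE w.
  by rewrite !inE uv uw => /esym/eqP-> /esym/eqP->.
have yx : adj y x by rewrite adj_sym.
have cl : closed (@adj G) [set x; y].
  apply: intro_closed; first exact: sym_connect_sym (@adj_sym G).
  move=> u v uv; rewrite !inE => /orP[] /eqP uE; rewrite {}uE in uv.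
    by rewrite (uniq_nb _ _ _ xy uv) eqxx orbT.
  by rewrite (uniq_nb _ _ _ yx uv) eqxx.
transitivity #|[set x; y]|; last by rewrite cards2 adj_neq.
apply: eq_card => z; rewrite -(closed_connect cl (conn x z)).
by rewrite !inE eqxx.
Qed.

Lemma path2_complete2 : isomorphic G (path_graph 2) <->
  isomorphic G (complete_graph 2).
Proof.
have adjE (i j : 'I_2) : path_adj i j = complete_adj i j.
  by case: i j => [[|[|//]] ?] [[|[|//]] ?].
by split=> -[f fB fadj]; exists f => // x y; rewrite -fadj /= adjE.
Qed.

Lemma isomorphic_path2 : (2 <= #|G|)%N -> connected G ->
  isomorphic G (path_graph 2) <-> forall x : G, degree x = 1%N.
Proof.
move=> G2 conn; split=> [iso | reg].
  have cG : #|G| = 2%N by case: iso => f /bij_eq_card -> _; rewrite card_ord.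
  by move/path2_complete2: iso; rewrite -cG isomorphic_complete cG.
have cG := connected_1regular_card G2 conn reg.
apply/path2_complete2; rewrite -cG; apply/isomorphic_complete => x.
by rewrite reg cG.
Qed.

End Graphs.

Theorem theorem2p1 (R : rcfType) (n : nat) (G : sgraph)
    (hcard : #|G| = n) (hn : (2 <= n)%N) (hconn : connected G) :
  [/\ Num.sqrt 2 * sum_connectivity R G <= geometric_arithmetic R G,
      geometric_arithmetic R G
        <= Num.sqrt (2 * (n%:R - 1)) * sum_connectivity R G,
      (Num.sqrt 2 * sum_connectivity R G = geometric_arithmetic R G
        <-> isomorphic G (path_graph 2)) &
      (geometric_arithmetic R G
          = Num.sqrt (2 * (n%:R - 1)) * sum_connectivity R G
        <-> isomorphic G (complete_graph n))].
Proof.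
subst n; have no_iso := connected_no_isolated hn hconn.
have deg1 (x : G) : (1 <= degree x)%N.
  by case: (no_iso x) => y /degree_gt0.
have [lb lbE] := ga_ge_leif R no_iso (ltn0Sn 0) deg1.
have [ub ubE] := ga_le_leif R no_iso (@degree_le G).
have n1 : (#|G|.-1)%:R = #|G|%:R - 1 :> R by rewrite -subn1 natrB // ltnW.
rewrite mulr1 in lb lbE; rewrite n1 in ub ubE.
split=> //.
- rewrite (isomorphic_path2 hn hconn); split=> [/eqP|reg].
    by rewrite lbE => /forallP reg x; rewrite -(eqP (reg x)).
  by apply/eqP; rewrite lbE; apply/forallP => x; rewrite reg.
- rewrite isomorphic_complete; split=> [/eqP|reg].
    by rewrite ubE => /forallP reg x; rewrite (eqP (reg x)).
  by apply/eqP; rewrite ubE; apply/forallP => x; rewrite reg.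
Qed.
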